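(* Let $(R,\mathfrak{m})$ be a commutative noetherian local ring, $M$ an $R$-module and $M\subset N$ a pure-injective hull of $M$. Then: (a) $\operatorname{Koatt}(N)=\operatorname{Koatt}(M)$. (b) $H(N)$ is radical-full and pure-injective. (c) $N/H(N)$ is a direct summand of a product of modules of finite length.
   Context: For an $R$-module $A$ put $H(A)=\bigcap_{n\ge1}\mathfrak{m}^nA$; $A$ is radical-full if $\mathfrak{m}A=A$. $\operatorname{Koatt}(A)$ is the set of primes $\mathfrak{p}$ of $R$ such that $\mathfrak{p}=\operatorname{Ann}_R(U)$ for some submodule $U\subset A$. A pure submodule $A\subset B$ is pure-essential in $B$ if every submodule $X\subset B$ with $X\cap A=0$ and $(X\oplus A)/X$ pure in $B/X$ is zero. A pure-injective hull of $M$ is a pure-essential extension $M\subset N$ with $N$ pure-injective. *)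

(* Defs.v *)
From HB Require Import structures.
From mathcomp Require Import all_boot all_algebra.
From mathcomp Require Import boolp classical_sets.

Set Implicit Arguments.
Unset Strict Implicit.
Unset Printing Implicit Defensive.

Import GRing.Theory.
Local Open Scope ring_scope.

(* Submodules of an R-module V are the [submodClosed V] of the library. These
   are boolean predicates, but excluded middle makes every Prop-valued one
   boolean, so no decidability restriction is involved. Ideals are the
   submodules of the regular module R^o; proper (resp. prime) ideals are also
   available as the library's [idealr R] (resp. [prime_idealr R]), both of
   which exclude the unit ideal. *)

Section Submodules.
Variable R : comNzRingType.
Implicit Types A B V : lmodType R.

Definition fullmod V : {pred V} := predT.

Lemma fullmod_closed V : submod_closed (@fullmod V).
Proof. by []. Qed.
HB.instance Definition _ V :=
  GRing.isSubmodClosed.Build R V (@fullmod V) (fullmod_closed V).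

Definition submodD V (U W : submodClosed V) : {pred V} :=
  fun x => `[< exists u w, [/\ u \in U, w \in W & x = u + w] >].

Lemma submodD_closed V (U W : submodClosed V) : submod_closed (submodD U W).
Proof.
split; first by apply/asboolP; exists 0, 0; rewrite !rpred0 addr0.
move=> a x y /asboolP[u [w [uU wW ->]]] /asboolP[u' [w' [uU' wW' ->]]].
apply/asboolP; exists (a *: u + u'), (a *: w + w'); split.
- by rewrite rpredD // rpredZ.
- by rewrite rpredD // rpredZ.
- by rewrite scalerDr addrACA.
Qed.
HB.instance Definition _ V (U W : submodClosed V) :=
  GRing.isSubmodClosed.Build R V (submodD U W) (submodD_closed U W).

Definition submod_img A B (f : {linear A -> B}) (U : submodClosed A) :
    {pred B} :=
  fun y => `[< exists2 x, x \in U & y = f x >].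

Lemma submod_img_closed A B (f : {linear A -> B}) (U : submodClosed A) :
  submod_closed (submod_img f U).
Proof.
split; first by apply/asboolP; exists 0; rewrite ?rpred0 ?linear0.
move=> a x y /asboolP[u uU ->] /asboolP[v vU ->].
by apply/asboolP; exists (a *: u + v); rewrite ?rpredD ?rpredZ // linearP.
Qed.
HB.instance Definition _ A B (f : {linear A -> B}) (U : submodClosed A) :=
  GRing.isSubmodClosed.Build R B (submod_img f U) (submod_img_closed f U).

(* I U, the submodule generated by the products a *: u, a \in I, u \in U. *)
Definition smulmod V (I : {pred R}) (U : submodClosed V) : {pred V} :=
  fun x => `[< exists n (a : 'I_n -> R) (u : 'I_n -> V),
    [/\ forall i, a i \in I, forall i, u i \in U
      & x = \sum_(i < n) a i *: u i] >].

Lemma smulmod_closed V (I : {pred R}) (U : submodClosed V) :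
  submod_closed (smulmod I U).
Proof.
split.
  apply/asboolP; exists 0, (fun=> 0), (fun=> 0).
  by split=> [[]|[]|] //; rewrite big_ord0.
move=> c x y /asboolP[n [a [u [aI uU ->]]]] /asboolP[p [b [v [bI vU ->]]]].
apply/asboolP; exists (n + p).
exists (fun i => match split i with inl j => a j | inr j => b j end).
exists (fun i => match split i with inl j => c *: u j | inr j => v j end).
split=> [i|i|]; [by case: split | by case: split => j //; rewrite rpredZ |].
rewrite big_split_ord scaler_sumr /=; congr (_ + _); apply: eq_bigr => i _.
  by rewrite (unsplitK (inl i)) !scalerA mulrC.
by rewrite (unsplitK (inr i)).
Qed.
HB.instance Definition _ V (I : {pred R}) (U : submodClosed V) :=
  GRing.isSubmodClosed.Build R V (smulmod I U) (smulmod_closed I U).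

Fixpoint idealX (I : {pred R}) (n : nat) : submodClosed R^o :=
  if n is n'.+1 then smulmod I (idealX I n') else @fullmod R^o.

Definition Hmod (m : {pred R}) A : {pred A} :=
  fun x => `[< forall n, (1 <= n)%N -> x \in smulmod (idealX m n) (@fullmod A) >].

Lemma Hmod_closed (m : {pred R}) A : submod_closed (@Hmod m A).
Proof.
split; first by apply/asboolP => n _; rewrite rpred0.
move=> a x y /asboolP xH /asboolP yH; apply/asboolP => n n0.
by rewrite rpredD ?rpredZ ?xH ?yH.
Qed.
HB.instance Definition _ (m : {pred R}) A :=
  GRing.isSubmodClosed.Build R A (@Hmod m A) (Hmod_closed m A).

End Submodules.

Arguments fullmod {R} V.
Arguments Hmod {R} m A.

Definition submod_type (R : comNzRingType) (V : lmodType R)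
  (U : submodClosed V) := {x : V | x \in U}.

HB.instance Definition _ (R : comNzRingType) (V : lmodType R)
  (U : submodClosed V) := SubChoice.on (submod_type U).
HB.instance Definition _ (R : comNzRingType) (V : lmodType R)
  (U : submodClosed V) := [SubChoice_isSubLmodule of submod_type U by <:].

Section QuotientModule.
Variables (R : comNzRingType) (V : lmodType R) (U : submodClosed V).
Local Open Scope quotient_scope.

Lemma submod_oppr_closed : oppr_closed U.
Proof. by move=> x xU; rewrite -scaleN1r rpredZ. Qed.

Definition submod_zmod : zmodClosed V :=
  HB.pack (GRing.SubmodClosed.sort U)
    (GRing.isOppClosed.Build V (GRing.SubmodClosed.sort U) submod_oppr_closed).

Definition quot_mod := Quotient.quot submod_zmod.
HB.instance Definition _ := GRing.Zmodule.on quot_mod.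
HB.instance Definition _ : EqQuotient V (Quotient.equiv submod_zmod) quot_mod :=
  EqQuotient.on quot_mod.

Definition quot_pi (x : V) : quot_mod := \pi_quot_mod x.
Definition quot_scale (a : R) (x : quot_mod) : quot_mod :=
  quot_pi (a *: repr x).

Lemma quot_piE x y : (quot_pi x = quot_pi y) <-> (x - y \in U).
Proof. by rewrite (Quotient.idealrBE submod_zmod); split=> /eqP. Qed.

Lemma quot_piD x y : quot_pi (x + y) = quot_pi x + quot_pi y.
Proof. exact: (Quotient.pi_add submod_zmod). Qed.

Lemma quot_piZ a x : quot_pi (a *: x) = quot_scale a (quot_pi x).
Proof.
apply/quot_piE; rewrite -scalerBr rpredZ //; apply/quot_piE.
by rewrite /quot_pi reprK.
Qed.

Lemma quot_pi_surj y : exists x, y = quot_pi x.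
Proof. by exists (repr y); rewrite /quot_pi reprK. Qed.

Lemma quot_scaleA a b x :
  quot_scale a (quot_scale b x) = quot_scale (a * b) x.
Proof. by have [y ->] := quot_pi_surj x; rewrite -!quot_piZ scalerA. Qed.

Lemma quot_scale1 : left_id 1 quot_scale.
Proof. by move=> x; have [y ->] := quot_pi_surj x; rewrite -quot_piZ scale1r. Qed.

Lemma quot_scaleDr : right_distributive quot_scale +%R.
Proof.
move=> a x y; have [u ->] := quot_pi_surj x; have [v ->] := quot_pi_surj y.
by rewrite -(quot_piD u v) -!quot_piZ scalerDr quot_piD.
Qed.

Lemma quot_scaleDl x : {morph quot_scale^~ x : a b / a + b}.
Proof.
move=> a b; have [u ->] := quot_pi_surj x.
by rewrite -!quot_piZ -quot_piD scalerDl.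
Qed.

HB.instance Definition _ := GRing.Zmodule_isLmodule.Build R quot_mod
  quot_scaleA quot_scale1 quot_scaleDr quot_scaleDl.

Lemma quot_pi_linear : linear quot_pi.
Proof. by move=> a x y; rewrite quot_piD quot_piZ. Qed.
HB.instance Definition _ :=
  GRing.isLinear.Build R V quot_mod _ quot_pi quot_pi_linear.

End QuotientModule.

Section ProductModule.
Variables (R : comNzRingType) (I : Type) (F : I -> lmodType R).

Definition prod_mod := forall i, F i.
HB.instance Definition _ := Choice.copy prod_mod (forall i, F i).

Implicit Types f g h : prod_mod.
Let add f g : prod_mod := fun i => f i + g i.
Let opp f : prod_mod := fun i => - f i.
Let zero : prod_mod := fun i => 0.
Let scale (a : R) f : prod_mod := fun i => a *: f i.

Let addA : associative add.
Proof. by move=> f g h; apply: functional_extensionality_dep => i; exact: addrA. Qed.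
Let addC : commutative add.
Proof. by move=> f g; apply: functional_extensionality_dep => i; exact: addrC. Qed.
Let add0 : left_id zero add.
Proof. by move=> f; apply: functional_extensionality_dep => i; exact: add0r. Qed.
Let addN : left_inverse zero opp add.
Proof. by move=> f; apply: functional_extensionality_dep => i; exact: addNr. Qed.
HB.instance Definition _ :=
  GRing.isZmodule.Build prod_mod addA addC add0 addN.

Let scaleA a b f : scale a (scale b f) = scale (a * b) f.
Proof. by apply: functional_extensionality_dep => i; exact: scalerA. Qed.
Let scale1 : left_id 1 scale.
Proof. by move=> f; apply: functional_extensionality_dep => i; exact: scale1r. Qed.
Let scaleDr : right_distributive scale +%R.
Proof. by move=> a f g; apply: functional_extensionality_dep => i; exact: scalerDr. Qed.
Let scaleDl f : {morph scale^~ f : a b / a + b}.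
Proof. by move=> a b; apply: functional_extensionality_dep => i; exact: scalerDl. Qed.
HB.instance Definition _ := GRing.Zmodule_isLmodule.Build R prod_mod
  scaleA scale1 scaleDr scaleDl.

End ProductModule.

Section Notions.
Variable R : comNzRingType.
Implicit Types A B V : lmodType R.

Definition noetherian_ring : Prop :=
  forall I : submodClosed R^o, exists n (g : 'I_n -> R),
    forall x : R, x \in I <-> exists c : 'I_n -> R, x = \sum_(i < n) c i * g i.

Definition maximal_ideal (m : idealr R) : Prop :=
  forall J : idealr R, {subset m <= J} -> J =i m.

Definition local_ring (m : idealr R) : Prop :=
  maximal_ideal m /\ forall J : idealr R, maximal_ideal J -> J =i m.

Definition radical_full (m : {pred R}) A : Prop :=
  smulmod m (fullmod A) =i fullmod A.

Definition Koatt A : set (prime_idealr R) :=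
  [set p : prime_idealr R | exists U : submodClosed A,
    forall a : R, a \in p <-> {in U, forall u, a *: u = 0}]%classic.

(* Every finite system of linear equations with constants in U which is
   solvable in B is solvable in U. *)
Definition pure B (U : submodClosed B) : Prop :=
  forall (k l : nat) (r : 'M[R]_(k, l)) (c : 'I_k -> B),
    (forall i, c i \in U) ->
    (exists y : 'I_l -> B, forall i, \sum_(j < l) r i j *: y j = c i) ->
    exists2 y : 'I_l -> B, (forall j, y j \in U)
                         & (forall i, \sum_(j < l) r i j *: y j = c i).

Definition pure_essential B (A : submodClosed B) : Prop :=
  pure A /\
  forall X : submodClosed B,
    (forall x, x \in X -> x \in A -> x = 0) ->
    pure (submod_img (@quot_pi R B X) (submodD X A)) ->
    forall x, x \in X -> x = 0.

Definition pure_injective V : Prop :=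
  forall (A B : lmodType R) (f : {linear A -> B}),
    injective f -> pure (submod_img f (fullmod A)) ->
    forall g : {linear A -> V}, exists h : {linear B -> V}, h \o f =1 g.

(* The extension M \subset N is given by the injective linear map f. *)
Definition pure_injective_hull A B (f : {linear A -> B}) : Prop :=
  [/\ injective f, pure_essential (submod_img f (fullmod A))
    & pure_injective B].

(* Existence of a composition series; the values U i for i > n are junk. *)
Definition finite_length A : Prop :=
  exists n (U : nat -> submodClosed A),
    [/\ forall x, x \in U 0%N <-> x = 0, forall x, x \in U n
      & forall i, (i < n)%N ->
        [/\ {subset U i <= U i.+1}, ~ {subset U i.+1 <= U i}
          & forall W : submodClosed A, {subset U i <= W} ->
              {subset W <= U i.+1} -> W =i U i \/ W =i U i.+1]].

(* A is isomorphic to a direct summand of B. *)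
Definition direct_summand A B : Prop :=
  exists (C : lmodType R) (f : {linear (A * C)%type -> B}), bijective f.

End Notions.

(* Main.v *)
Require Import Defs.
From HB Require Import structures.
From mathcomp Require Import all_boot all_algebra.
From mathcomp Require Import boolp classical_sets filter.

(** Everything rests on one reformulation of pure-injectivity: [V] is
    pure-injective iff along every proper filter on a set [I] there is a
    generalized limit [V^I -> V], that is, a linear map which is the identity on
    constant families and which kills the families vanishing on a set of the
    filter ([pure_injective_limits], [has_limits_pure_injective]). One direction
    retracts [V] out of the reduced power [V^I/F], in which it sits purely; the
    other takes the limit of solutions of the finite systems of relations that
    an extension of a linear map has to satisfy. Because such a limit is linear,
    it respects every condition expressed by finitely many linear equations, in
    particular membership in [m^n V], the ideal [m^n] being finitely generated.

    (a) A prime [p] is coattached to [A] iff [p] is the annihilator of the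
    submodule [A[p]] of elements killed by [p]. So the claim is that an [a]
    which kills [M[p]] also kills [N[p]]. For such an [a], the submodule
    [a N[p]] meets [M] trivially and leaves [M] pure in the quotient, since
    [p] is finitely generated and [M] is pure in [N]; by pure-essentiality it
    is zero ([pure_essential_annihilator]).

    (b) An element of [H(N)] can be written, for every [n], as a combination of
    fixed generators of [m] with coefficients in [m^n N]. The limit over [n] of
    these coefficients lies in [H(N)], so that [m H(N) = H(N)]. Limits
    along any filter preserve [H(N)], hence restrict to [H(N)] and descend to
    [N/H(N)]; both are therefore pure-injective.

    (c) As [N/H(N)] is pure-injective, it is enough to embed it purely in a
    product of modules of finite length, and the product of all the quotients
    [N/W] of finite length with [H(N)] contained in [W] will do. Consider a
    system of [k] equations without solution in [N/H(N)]. Taking limits, it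
    already has no solution in [N/m^n N] for some [n]. Enlarge the submodule of
    [N^k] formed by the solvable right-hand sides modulo [m^n N] to a submodule
    [D] maximal among those avoiding the given right-hand side. Every nonzero
    submodule of [N^k/D] contains the class of that right-hand side, and
    [N^k/D] is killed by [m^n]; this forces finite length
    ([ranked_avoiding]). The kernel [W] of the [k] coordinate maps
    [N -> N^k/D] is then such that [N/W] has finite length and that the system
    stays unsolvable in [N/W] ([unsolvable_finite_length]). *)

Set Implicit Arguments.
Unset Strict Implicit.
Unset Printing Implicit Defensive.

Import GRing.Theory.
Local Open Scope ring_scope.

(** * Submodules, quotients and pure maps *)

Section Submod.
Variable R : comNzRingType.
Implicit Types A B V : lmodType R.

Definition submod_prop V (P : V -> Prop) : Prop :=
  P 0 /\ forall a x y, P x -> P y -> P (a *: x + y).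

(** The closure proof is an argument of the carrier so that the submodule
    structure can be inferred from it. *)
Definition submod_of V (P : V -> Prop) (cP : submod_prop P) : {pred V} :=
  fun x => `[< P x >].

Lemma submod_of_closed V P cP : submod_closed (@submod_of V P cP).
Proof.
split; first by apply/asboolP; exact: cP.1.
by move=> a x y /asboolP Px /asboolP Py; apply/asboolP; exact: cP.2.
Qed.
HB.instance Definition _ V P cP :=
  GRing.isSubmodClosed.Build R V (@submod_of V P cP) (submod_of_closed cP).

Lemma in_submod_of V P (cP : submod_prop P) (x : V) :
  (x \in submod_of cP) <-> P x.
Proof. by split=> [/asboolP|Px] //; apply/asboolP. Qed.

Lemma in_fullmod V (x : V) : x \in fullmod V. Proof. by []. Qed.

Lemma ker_closed A B (f : {linear A -> B}) : submod_prop (fun x => f x = 0).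
Proof.
by split=> [|a x y fx fy]; rewrite ?linear0 // linearP fx fy scaler0 addr0.
Qed.
Definition kermod A B (f : {linear A -> B}) : submodClosed A :=
  submod_of (ker_closed f).

Lemma in_kermod A B (f : {linear A -> B}) x : (x \in kermod f) <-> f x = 0.
Proof. exact: in_submod_of. Qed.

Lemma ann_closed V (I : {pred R}) :
  submod_prop (fun x : V => forall a, a \in I -> a *: x = 0).
Proof.
split=> [a _|a x y xI yI b bI]; first exact: scaler0.
by rewrite scalerDr scalerA mulrC -scalerA xI // yI // scaler0 addr0.
Qed.
Definition annmod V (I : {pred R}) : submodClosed V :=
  submod_of (@ann_closed V I).

Lemma in_annmod V (I : {pred R}) (x : V) :
  (x \in annmod V I) <-> forall a, a \in I -> a *: x = 0.
Proof. exact: in_submod_of. Qed.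

Lemma line_closed V (x : V) : submod_prop (fun y => exists a : R, y = a *: x).
Proof.
split=> [|a _ _ [b ->] [c ->]]; first by exists 0; rewrite scale0r.
by exists (a * b + c); rewrite scalerDl scalerA.
Qed.
Definition line V (x : V) : submodClosed V := submod_of (line_closed x).

Lemma in_line V (x y : V) : (y \in line x) <-> exists a : R, y = a *: x.
Proof. exact: in_submod_of. Qed.

Lemma in_submodD V (U W : submodClosed V) x :
  (x \in submodD U W) <-> exists u w, [/\ u \in U, w \in W & x = u + w].
Proof. by split=> /asboolP. Qed.

Lemma in_submod_img A B (f : {linear A -> B}) (U : submodClosed A) y :
  (y \in submod_img f U) <-> exists2 x, x \in U & y = f x.
Proof. by split=> /asboolP. Qed.

Lemma quot_repr V (U : submodClosed V) (x : quot_mod U) :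
  quot_pi U (repr x) = x.
Proof. by rewrite /quot_pi reprK. Qed.

Lemma quot_pi_eq0 V (U : submodClosed V) x : (quot_pi U x = 0) <-> (x \in U).
Proof. by rewrite -(linear0 (@quot_pi R V U)) quot_piE subr0. Qed.

Section Lift.
Variables (A B : lmodType R) (U : submodClosed A) (f : {linear A -> B}).
Hypothesis fU : forall x, x \in U -> f x = 0.

Definition quot_lift (x : quot_mod U) : B := f (repr x).

Lemma quot_liftE x : quot_lift (quot_pi U x) = f x.
Proof.
apply/eqP; rewrite -subr_eq0 -linearB; apply/eqP/fU.
by apply/quot_piE; rewrite quot_repr.
Qed.

Lemma quot_lift_linear : linear quot_lift.
Proof.
move=> a x y; have [u ->] := quot_pi_surj x; have [v ->] := quot_pi_surj y.
by rewrite -(linearP (@quot_pi R A U)) !quot_liftE linearP.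
Qed.
End Lift.

Lemma quot_lift_ex A B (U : submodClosed A) (f : {linear A -> B}) :
  (forall x, x \in U -> f x = 0) ->
  exists g : {linear quot_mod U -> B}, forall x, g (quot_pi U x) = f x.
Proof.
move=> fU; pose g : {linear quot_mod U -> B} := HB.pack (@quot_lift A B U f)
  (GRing.isLinear.Build _ _ _ _ _ (quot_lift_linear fU)).
by exists g => x; exact: quot_liftE.
Qed.

(** Purity of the image of [f], with the constants and the solutions taken in
    the domain. It includes the injectivity of [f]: see [pure_map_inj]. *)
Definition pure_map A B (f : {linear A -> B}) : Prop :=
  forall (k l : nat) (r : 'M[R]_(k, l)) (c : 'I_k -> A),
    (exists y : 'I_l -> B, forall i, \sum_(j < l) r i j *: y j = f (c i)) ->
    exists y : 'I_l -> A, forall i, \sum_(j < l) r i j *: y j = c i.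

Lemma pure_map_inj A B (f : {linear A -> B}) : pure_map f -> injective f.
Proof.
move=> fP x y fxy; apply/eqP; rewrite -subr_eq0; apply/eqP.
(* The equation 0 = x - y in no unknown. *)
have [|z /(_ ord0)] := fP 1%N 0%N (\matrix_(i, j) 0) (fun=> x - y).
  by exists (fun=> 0) => i; rewrite big_ord0 linearB /= fxy subrr.
by rewrite big_ord0.
Qed.

Lemma pure_mapP A B (f : {linear A -> B}) : injective f ->
  pure (submod_img f (fullmod A)) <-> pure_map f.
Proof.
move=> f_inj; split=> fP k l r c => [[y yE]|cA [y yE]].
  have [||z zA zE] := fP k l r (fun i => f (c i)).
  - by move=> i; apply/in_submod_img; exists (c i).
  - by exists y.
  have /choice[u uE] : forall j, exists u, z j = f u.
    by move=> j; have /in_submod_img[u _ ->] := zA j; exists u.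
  exists u => i; apply: f_inj; rewrite -zE linear_sum.
  by apply: eq_bigr => j _; rewrite linearZ uE.
have /choice[u uE] : forall i, exists u, c i = f u.
  by move=> i; have /in_submod_img[u _ ->] := cA i; exists u.
have [|z zE] := fP k l r u; first by exists y => i; rewrite yE.
exists (fun j => f (z j)) => [j|i]; first by apply/in_submod_img; exists (z j).
by rewrite uE -zE linear_sum; apply: eq_bigr => j _; rewrite linearZ.
Qed.

Lemma pure_injectiveP V : pure_injective V <->
  forall (A B : lmodType R) (f : {linear A -> B}), pure_map f ->
    forall g : {linear A -> V}, exists h : {linear B -> V}, h \o f =1 g.
Proof.
split=> VP A B f; last by move=> f_inj /(pure_mapP f_inj); exact: VP.
by move=> fP; have f_inj := pure_map_inj fP; apply/VP/pure_mapP.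
Qed.

End Submod.

(** * Pure-injectivity and limits along filters *)

Section Limits.
Variable R : comNzRingType.
Implicit Types A B V : lmodType R.

Definition power (I : Type) V : lmodType R := @prod_mod R I (fun=> V).

Lemma sum_power I V n (x : 'I_n -> power I V) i :
  (\sum_(j < n) x j) i = \sum_(j < n) x j i.
Proof. by elim/big_ind2: _ => // a b c d <- <-. Qed.

(** Generalized limits: a family counts only through its germ along [F], by
    [flimit_eq]. *)
Definition flimit I (F : set_system I) V (L : {linear power I V -> V}) : Prop :=
  (forall v, L (fun=> v) = v) /\
  (forall x : power I V, F [set i | x i = 0]%classic -> L x = 0).

Definition has_limits V : Prop :=
  forall (I : Type) (F : set_system I), ProperFilter F ->
    exists L : {linear power I V -> V}, flimit F L.

Lemma flimit_eq I (F : set_system I) V (L : {linear power I V -> V}) x y :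
  flimit F L -> F [set i | x i = y i]%classic -> Filter F -> L x = L y.
Proof.
move=> [_ L0] xy FF; apply/eqP; rewrite -subr_eq0 -linearB; apply/eqP/L0.
by apply: filterS xy => i /= xyi; rewrite -[LHS]/(x i - y i) xyi subrr.
Qed.

Lemma flimit_sum I V (L : {linear power I V -> V})
    n (r : 'I_n -> R) (y : 'I_n -> power I V) :
  L (fun i => \sum_(j < n) r j *: y j i) = \sum_(j < n) r j *: L (y j).
Proof.
have -> : (fun i => \sum_(j < n) r j *: y j i) = \sum_(j < n) r j *: y j.
  by apply: functional_extensionality_dep => i; rewrite sum_power.
by rewrite linear_sum; apply: eq_bigr => j _; rewrite linearZ.
Qed.

Lemma null_closed I (F : set_system I) V : Filter F ->
  submod_prop (fun x : power I V => F [set i | x i = 0]%classic).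
Proof.
move=> FF; split=> [|a x y x0 y0].
  by apply: filterS filterT.
apply: filterS2 x0 y0 => i /= xi yi.
by rewrite -[LHS]/(a *: x i + y i) xi yi scaler0 addr0.
Qed.

(** The diagonal of [V] in the reduced power [V^I/F] is pure: a finite system
    solved in the reduced power is solved at all the indices of a set of [F],
    which is not empty. A retraction of the diagonal is a limit along [F]. *)
Lemma pure_injective_limits V : pure_injective V -> has_limits V.
Proof.
move=> /pure_injectiveP VP I F FF; pose Z := submod_of (null_closed V FF).
have d_lin : linear (fun v => quot_pi Z ((fun=> v) : power I V)).
  by move=> a v w; rewrite -linearP.
pose d : {linear V -> quot_mod Z} :=
  HB.pack (fun v => quot_pi Z ((fun=> v) : power I V))
    (GRing.isLinear.Build _ _ _ _ _ d_lin).
have dP : pure_map d.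
  move=> k l r c [y yE].
  have /choice[u uE] : forall j, exists u, y j = quot_pi Z u.
    by move=> j; exact: quot_pi_surj.
  have FE i : F [set s | \sum_(j < l) r i j *: u j s = c i]%classic.
    have : \sum_(j < l) r i j *: u j - ((fun=> c i) : power I V) \in Z.
      apply/quot_piE; rewrite -[RHS]/(d (c i)) -yE linear_sum.
      by apply: eq_bigr => j _; rewrite linearZ uE.
    move=> /in_submod_of; apply: filterS => s /= /eqP.
    rewrite -[X in X == 0]/((\sum_(j < l) r i j *: u j) s - c i) subr_eq0.
    by rewrite sum_power => /eqP.
  have /filter_ex[s sE] : F [set s | forall i : 'I_k,
      \sum_(j < l) r i j *: u j s = c i]%classic.
    exact: filter_forall.
  by exists (fun j => u j s).
have [h hE] := VP _ _ d dP idfun.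
exists (h \o quot_pi Z); split=> [v|x x0] /=; first exact: hE.
by have /quot_pi_eq0-> : x \in Z; [exact/in_submod_of|rewrite linear0].
Qed.

(** Purity restated for a finite list of relations between arbitrary elements of
    [B], where a relation is a list of terms [(coefficient, element)] and a
    right-hand side in [A]. The list may contain false relations, which [y] need
    not preserve. *)
Lemma pure_finite_solution A B (f : {linear A -> B}) : pure_map f ->
  forall s : seq (seq (R * B) * A),
  exists y : B -> A, forall t, t \in s ->
    \sum_(p <- t.1) p.1 *: p.2 = f t.2 -> \sum_(p <- t.1) p.1 *: y p.2 = t.2.
Proof.
move=> fP s0.
pose s := [seq t <- s0 | \sum_(p <- t.1) p.1 *: p.2 == f t.2].
(* The unknowns are indexed by the distinct elements of B that occur. *)
pose L := undup [seq p.2 | p <- flatten [seq t.1 | t <- s]].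
pose e (j : 'I_(size L)) := L`_j.
pose r := \matrix_(i < size s, j < size L)
  \sum_(p <- (tnth (in_tuple s) i).1 | e j == p.2) p.1.
have sumE (W : lmodType R) (y : 'I_(size L) -> W) i :
    \sum_j r i j *: y j =
    \sum_(p <- (tnth (in_tuple s) i).1) p.1 *: \sum_(j | e j == p.2) y j.
  transitivity (\sum_j \sum_(p <- (tnth (in_tuple s) i).1 | e j == p.2)
                   p.1 *: y j).
    by apply: eq_bigr => j _; rewrite mxE scaler_suml.
  rewrite (exchange_big_dep predT) //=; apply: eq_bigr => p _.
  by rewrite scaler_sumr.
have [|y yE] := fP _ _ r (fun i => (tnth (in_tuple s) i).2).
  exists e => i; rewrite sumE.
  have /[dup] ti := mem_tnth i (in_tuple s).
  rewrite mem_filter => /andP[/eqP <- _].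
  rewrite !big_seq; apply: eq_bigr => p pi; congr (_ *: _).
  have pL : p.2 \in L.
    rewrite mem_undup; apply/mapP; exists p => //.
    by apply/flattenP; exists (tnth (in_tuple s) i).1; rewrite ?map_f.
  have iL : (index p.2 L < size L)%N by rewrite index_mem.
  rewrite (big_pred1 (Ordinal iL)) /e /= ?nth_index // => j /=.
  rewrite -[in LHS](nth_index 0 pL) nth_uniq ?undup_uniq //.
exists (fun b => \sum_(j | e j == b) y j) => t ts0 tE.
have ts : t \in s by rewrite mem_filter tE eqxx.
have /tnthP[i ti] : t \in in_tuple s by [].
by rewrite ti -yE sumE.
Qed.

(** Every finite set of the relations over [A] that hold in [B] is realized
    by some map [B -> A]. Composing these maps with [g] and taking the limit
    over the finite sets of relations, one gets a map which satisfies all of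
    them: it is linear and extends [g]. *)
Lemma has_limits_pure_injective V : has_limits V -> pure_injective V.
Proof.
move=> VL; apply/pure_injectiveP => A B f fP g.
have /choice[y yE] := pure_finite_solution fP.
pose T : eqType := (seq (R * B) * A)%type.
pose F : set_system (seq T) :=
  filter_from setT
    (fun s0 : seq T => [set s : seq T | {subset s0 <= s}]%classic).
have FF : ProperFilter F.
  apply: filter_from_proper => [|s _]; last by exists s.
  apply: filter_from_filter => [|s t _ _]; first by exists [::].
  exists (s ++ t) => // u stu.
  by split=> x xs; apply: stu; rewrite mem_cat xs ?orbT.
have [L LF] := VL _ F FF.
pose h b := L (fun s => g (y s b)).
have hE (ps : seq (R * B)) a : \sum_(p <- ps) p.1 *: p.2 = f a ->
    \sum_(p <- ps) p.1 *: h p.2 = g a.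
  move=> psE.
  have <- := LF.1 (g a).
  transitivity (L (fun s => g (\sum_(p <- ps) p.1 *: y s p.2))).
    rewrite (big_nth 0) big_mkord -flimit_sum; apply: (congr1 L).
    apply: functional_extensionality_dep => s.
    rewrite (big_nth 0) big_mkord linear_sum.
    by apply: eq_bigr => i _; rewrite linearZ.
  apply: (flimit_eq LF).
  exists [:: (ps, a)] => // s /= sP; congr (g _).
  by apply: (yE s (ps, a)) psE; apply: sP; rewrite inE.
have h_lin : linear h.
  move=> a x z; pose ps := [:: (1, a *: x + z); (- a, x); (-1, z)].
  have := hE ps 0; rewrite !big_cons !big_nil /= !linear0 !addr0 !scale1r.
  rewrite !scaleN1r !scaleNr addrA => /(_ _)/eqP; rewrite -!opprD subr_eq0.
  by move=> H; apply/eqP/H; rewrite -addrA -opprD subrr.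
pose h' : {linear B -> V} := HB.pack h (GRing.isLinear.Build _ _ _ _ _ h_lin).
exists h' => a /=; have := hE [:: (1, f a)] a.
by rewrite !big_cons !big_nil /= !addr0 !scale1r => ->.
Qed.

End Limits.

(** * Powers of an ideal and the submodule H *)

Section Smul.
Variable R : comNzRingType.
Implicit Types A B V : lmodType R.

Lemma mem_smulmod V (I : {pred R}) (U : submodClosed V) a u :
  a \in I -> u \in U -> a *: u \in smulmod I U.
Proof.
move=> aI uU; apply/asboolP; exists 1%N, (fun=> a), (fun=> u).
by rewrite big_ord1.
Qed.

Lemma smulmod_sub V (I : {pred R}) (U W : submodClosed V) :
  (forall a u, a \in I -> u \in U -> a *: u \in W) ->
  {subset smulmod I U <= W}.
Proof.
move=> IUW x /asboolP[n [a [u [aI uU ->]]]].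
by apply: rpred_sum => i _; exact: IUW.
Qed.

Lemma smulmodS V (I J : {pred R}) (U W : submodClosed V) :
  {subset I <= J} -> {subset U <= W} -> {subset smulmod I U <= smulmod J W}.
Proof.
by move=> IJ UW; apply: smulmod_sub => a u /IJ aJ /UW; exact: mem_smulmod.
Qed.

Lemma smulmodA V (I : {pred R}) (J : submodClosed R^o) (U : submodClosed V) :
  {subset smulmod (smulmod I J) U <= smulmod I (smulmod (J : {pred R}) U)}.
Proof.
apply: smulmod_sub => _ u /asboolP[n [a [b [aI bJ ->]]]] uU.
rewrite scaler_suml; apply: rpred_sum => i _.
by rewrite -scalerA; do 2!apply: mem_smulmod => //.
Qed.

Definition generates (I : {pred R}) p (g : 'I_p -> R) : Prop :=
  forall a : R, a \in I <-> exists c : 'I_p -> R, a = \sum_(t < p) c t * g t.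

Lemma generates_mem (I : {pred R}) p (g : 'I_p -> R) t :
  generates I g -> g t \in I.
Proof.
move=> gI; apply/gI; exists (fun s => (s == t)%:R).
rewrite (bigD1 t) //= eqxx mul1r big1 ?addr0 // => s /negPf->.
by rewrite mul0r.
Qed.

Lemma smulmod_gen V (I : {pred R}) p (g : 'I_p -> R) (U : submodClosed V) x :
  generates I g ->
  x \in smulmod I U <->
  exists2 z : 'I_p -> V, forall t, z t \in U & x = \sum_(t < p) g t *: z t.
Proof.
move=> gI; have gIt t := generates_mem t gI.
split=> [/asboolP[n [a [u [aI uU ->]]]]|[z zU ->]]; last first.
  by apply: rpred_sum => t _; exact: mem_smulmod.
have /choice[c cE] : forall i, exists c : 'I_p -> R,
    a i = \sum_(t < p) c t * g t.
  by move=> i; exact/gI.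
exists (fun t => \sum_i c i t *: u i) => [t|].
  by apply: rpred_sum => i _; rewrite rpredZ.
under [RHS]eq_bigr do rewrite scaler_sumr.
rewrite exchange_big; apply: eq_bigr => i _ /=.
rewrite cE scaler_suml; apply: eq_bigr => t _.
by rewrite scalerA mulrC.
Qed.

Definition adic (m : {pred R}) n V : submodClosed V :=
  smulmod (idealX m n : {pred R}) (fullmod V).

Lemma in_adic0 m V x : x \in adic m 0 V.
Proof. by rewrite -[x]scale1r mem_smulmod. Qed.

Lemma adicS m n V : {subset adic m n.+1 V <= smulmod m (adic m n V)}.
Proof. exact: smulmodA. Qed.

Lemma adic_le m n k V : (n <= k)%N -> {subset adic m k V <= adic m n V}.
Proof.
move=> /subnK <-; elim: (k - n)%N => // d IHd x xd; apply: IHd.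
apply: smulmodS xd => //.
apply: (@smulmod_sub R^o m (idealX m (d + n)) (idealX m (d + n))) => a u _.
exact: rpredZ.
Qed.

Lemma in_Hmod (m : {pred R}) V x :
  x \in Hmod m V <-> forall n, x \in adic m n V.
Proof.
split=> [/asboolP xH [|n]|xH]; first exact: in_adic0.
  exact: xH.
by apply/asboolP => n _; exact: xH.
Qed.

Definition flimit_closed V (U : submodClosed V) : Prop :=
  forall (I : Type) (F : set_system I) (L : {linear power I V -> V}),
    ProperFilter F -> flimit F L ->
    forall x : power I V, F [set i | x i \in U]%classic -> L x \in U.

(** An element of [J V] is a combination of finitely many fixed generators of
    [J], with coefficients in [V]; the limits of the coefficients are
    coefficients for the limit. *)
Lemma noetherian_smulmod_closed V (J : submodClosed R^o) :
  noetherian_ring R -> flimit_closed (smulmod (J : {pred R}) (fullmod V)).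
Proof.
move=> R_noeth I F L FF LF x xJ; have [p [g gJ]] := R_noeth J.
have /choice[z zE] : forall i, exists z : 'I_p -> V,
    x i \in smulmod (J : {pred R}) (fullmod V) -> x i = \sum_(t < p) g t *: z t.
  move=> i; have [[z zE]|nz] := pselect (exists z : 'I_p -> V,
      x i = \sum_(t < p) g t *: z t); first by exists z.
  by exists (fun=> 0) => /(smulmod_gen _ _ gJ)[z _ zE]; case: nz; exists z.
have -> : L x = L (fun i => \sum_(t < p) g t *: z i t).
  by apply: (flimit_eq LF); apply: filterS xJ => i; exact: zE.
rewrite (flimit_sum L g (fun t i => z i t)); apply/(smulmod_gen _ _ gJ).
by exists (fun t => L (fun i => z i t)).
Qed.

Lemma Hmod_flimit_closed m V : noetherian_ring R -> flimit_closed (Hmod m V).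
Proof.
move=> R_noeth I F L FF LF x xH; apply/in_Hmod => n.
apply: (noetherian_smulmod_closed R_noeth _ LF).
by apply: filterS xH => i /in_Hmod; exact.
Qed.

Lemma has_limits_submod V (U : submodClosed V) :
  flimit_closed U -> has_limits V -> has_limits (submod_type U).
Proof.
move=> Ucl VL I F FF; have [L LF] := VL I F FF.
have LU (x : power I (submod_type U)) : L (fun i => val (x i)) \in U.
  apply: (Ucl _ _ _ FF LF); apply: filterS filterT => i _; exact: valP (x i).
pose L' (x : power I (submod_type U)) : submod_type U :=
  exist (fun v => v \in U) _ (LU x).
have L'_lin : linear L'.
  move=> a x y; apply: val_inj; rewrite linearP /= -linearP; apply: (congr1 L).
  exact: functional_extensionality_dep.
pose L'' : {linear power I (submod_type U) -> submod_type U} :=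
  HB.pack L' (GRing.isLinear.Build _ _ _ _ _ L'_lin).
exists L''.
split=> [v|x x0]; apply: val_inj => /=; first exact: LF.1.
by rewrite LF.2 //; apply: filterS x0 => i /= ->.
Qed.

(** Limits descend to the quotient through arbitrary representatives, because
    changing the representatives changes the limit by an element of [U]. *)
Lemma has_limits_quot V (U : submodClosed V) :
  flimit_closed U -> has_limits V -> has_limits (quot_mod U).
Proof.
move=> Ucl VL I F FF; have [L LF] := VL I F FF.
pose lift (x : power I (quot_mod U)) : power I V :=
  fun i => repr (x i : quot_mod U).
pose L' x := quot_pi U (L (lift x)).
have L'_lin : linear L'.
  move=> a x y; rewrite -linearP -linearP; apply/quot_piE.
  rewrite -linearB; apply: (Ucl _ _ _ FF LF); apply: filterS filterT => i _.
  apply/quot_piE.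
  rewrite (linearP (@quot_pi R V U) a (lift x i) (lift y i)).
  rewrite /lift quot_repr; congr (_ + _); first congr (_ *: _);
    exact: (esym (quot_repr _)).
pose L'' : {linear power I (quot_mod U) -> quot_mod U} :=
  HB.pack L' (GRing.isLinear.Build _ _ _ _ _ L'_lin).
exists L''.
split=> [v|x x0] /=.
  by rewrite /L' /lift LF.1 quot_repr.
apply/quot_pi_eq0; apply: (Ucl _ _ _ FF LF); apply: filterS x0 => i /= xi.
by apply/quot_pi_eq0; rewrite quot_repr.
Qed.

Lemma noetherian_ideal_gen (m : idealr R) : noetherian_ring R ->
  exists p (g : 'I_p -> R), generates m g.
Proof.
move=> R_noeth.
have m_closed : submod_prop (fun x : R^o => x \in m).
  by split=> [|a x y xm ym]; rewrite ?rpred0 // rpredD // idealMr.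
have [p [g gE]] := R_noeth (submod_of m_closed).
by exists p, g => a; rewrite -gE; exact: iff_sym (in_submod_of m_closed a).
Qed.

(** The coefficients [y n] of an element of [H(V)] on generators of [m] can be
    chosen in [m^n V] for each [n]; their limits along [n] lie in all the
    [m^k V]. *)
Lemma Hmod_radical_full (m : idealr R) V :
  noetherian_ring R -> has_limits V -> radical_full m (submod_type (Hmod m V)).
Proof.
move=> R_noeth VL x; rewrite [RHS]in_fullmod.
have [p [g gE]] := noetherian_ideal_gen m R_noeth.
have /choice[y yE] : forall n, exists y : 'I_p -> V,
    (forall t, y t \in adic m n V) /\ val x = \sum_(t < p) g t *: y t.
  (* x lies in m^(n+1) V = m (m^n V). *)
  move=> n; have /in_Hmod/(_ n.+1)/adicS/(smulmod_gen _ _ gE) := valP x.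
  by case=> y ym xE; exists y.
have [L LF] := VL _ _ eventually_filter.
pose z t : V := L (fun n => y n t).
have zH t : z t \in Hmod m V.
  apply/in_Hmod => k; apply: (noetherian_smulmod_closed R_noeth _ LF).
  exists k => // n /= kn; exact: (adic_le kn ((yE n).1 t)).
apply/(smulmod_gen _ _ gE).
exists (fun t => exist (fun v => v \in Hmod m V) (z t) (zH t)) => //.
apply: val_inj; rewrite linear_sum /=.
rewrite -(flimit_sum L g (fun t n => y n t)) -[LHS]LF.1; apply: (congr1 L).
by apply: functional_extensionality_dep => n; exact: (yE n).2.
Qed.

End Smul.

(** * Coattached primes *)

Section Koattached.
Variable R : comNzRingType.
Implicit Types A B M N V : lmodType R.

(** The submodule [X = a N[p]] is zero by pure-essentiality. If [a x] comes from
    [M], where [p x = 0], then by purity it is [a x'] with [x'] in [M] and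
    [p x' = 0], hence it is zero. Likewise a system with right-hand sides [w i]
    which is solved in [N/X] is a system [.. - a (n i) = w i] together with
    [p (n i) = 0], solved in [N]; in a solution in [M] the terms [a (n i)]
    vanish. *)
Lemma pure_essential_annihilator M N (f : {linear M -> N}) (p : idealr R) a :
  noetherian_ring R -> injective f ->
  pure_essential (submod_img f (fullmod M)) ->
  {in annmod M p, forall x, a *: x = 0} ->
  {in annmod N p, forall x, a *: x = 0}.
Proof.
move=> R_noeth f_inj [/(pure_mapP f_inj) fP f_ess] aM.
have [q [g gE]] := noetherian_ideal_gen p R_noeth.
have annE V (x : V) : (forall t, g t *: x = 0) -> x \in annmod V p.
  move=> gx; apply/in_annmod => b /gE[c ->]; rewrite scaler_suml big1 // => t _.
  by rewrite -scalerA gx scaler0.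
have gann V (x : V) t : x \in annmod V p -> g t *: x = 0.
  by move=> /in_annmod; apply; exact: generates_mem.
pose X := submod_img ( *:%R a : {linear N -> N}) (annmod N p).
suff X0 x : x \in X -> x = 0.
  by move=> x xp; apply: X0; apply/in_submod_img; exists x.
(* An element of X :&: M is zero. *)
apply: (f_ess X) x => [_ /in_submod_img[x xp ->] /in_submod_img[w _ wE]|].
  have [y yE] := pure_finite_solution fP
    (([:: (a, x)], w) :: [seq ([:: (g t, x)], 0) | t <- enum 'I_q]).
  have := yE ([:: (a, x)], w).
  rewrite !big_seq1 /= wE inE eqxx => /(_ isT erefl) <-.
  rewrite aM ?linear0 //; apply: annE => t; have := yE ([:: (g t, x)], 0).
  rewrite !big_seq1 /= linear0 gann // => -> //.
  by rewrite inE map_f ?orbT // mem_enum.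
(* The submodule (X + M)/X is pure in N/X. *)
move=> k l r c cX [z zE].
have /choice[w wE] : forall i, exists w, c i = quot_pi X (f w).
  move=> i; have /in_submod_img[e /in_submodD[x [v []]]] := cX i.
  move=> /quot_pi_eq0 x0 /in_submod_img[w _ ->] -> ->.
  by exists w; rewrite linearD /= x0 add0r.
have /choice[u uE] : forall j, exists u, z j = quot_pi X u.
  by move=> j; exact: quot_pi_surj.
have /choice[n nE] : forall i, exists n, n \in annmod N p /\
    \sum_j r i j *: u j - f (w i) = a *: n.
  move=> i; have : \sum_j r i j *: u j - f (w i) \in X.
    apply/quot_piE; rewrite -wE -zE linear_sum.
    by apply: eq_bigr => j _; rewrite linearZ uE.
  by move=> /in_submod_img[n np E]; exists n.
pose eq1 i := ([seq (r i j, u j) | j <- index_enum _] ++ [:: (- a, n i)], w i).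
pose eq2 i t : seq (R * N) * M := ([:: (g t, n i)], 0).
have [y yE] := pure_finite_solution fP
  ([seq eq1 i | i <- enum 'I_k] ++
   [seq eq2 i t | i <- enum 'I_k, t <- enum 'I_q]).
have yp i : y (n i) \in annmod M p.
  apply: annE => t; have := yE (eq2 i t).
  rewrite /eq2 !big_seq1 /= linear0 gann ?(nE i).1 // => -> //.
  by rewrite mem_cat allpairs_f ?mem_enum ?orbT.
exists (fun j => quot_pi X (f (y (u j)))) => [j|i].
  apply/in_submod_img; exists (f (y (u j))) => //; apply/in_submodD.
  exists 0, (f (y (u j))); rewrite add0r rpred0; split=> //.
  by apply/in_submod_img; exists (y (u j)).
have := yE (eq1 i); rewrite /eq1 /= !big_cat !big_map /= !big_seq1 /=.
rewrite !scaleNr -(nE i).2 opprB addrCA subrr addr0 (aM _ (yp i)) subr0.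
rewrite mem_cat map_f ?mem_enum // => /(_ isT erefl) wiE.
rewrite wE -wiE !linear_sum; apply: eq_bigr => j _.
by rewrite !linearZ.
Qed.

(** If [p] is the annihilator of some submodule then it is that of the largest
    submodule killed by [p]. *)
Lemma Koatt_pure_essential M N (f : {linear M -> N}) :
  noetherian_ring R -> injective f ->
  pure_essential (submod_img f (fullmod M)) ->
  Koatt N = Koatt M.
Proof.
move=> R_noeth f_inj f_ess; apply/seteqP; split=> p /= [U pU].
  exists (annmod M p) => a; split=> [ap x /in_annmod|aM]; first exact.
  apply/pU => u uU.
  apply: (pure_essential_annihilator R_noeth f_inj f_ess aM).
  by apply/in_annmod => b /pU; exact.
pose fU : submodClosed N := submod_img f U.
exists fU => a; split=> [/pU aU _ /in_submod_img[u uU ->]|aU].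
  by rewrite -linearZ aU ?linear0.
apply/pU => u uU; apply: f_inj; rewrite linearZ linear0 /= aU //.
by apply/in_submod_img; exists u.
Qed.
End Koattached.

(** * Modules of finite length *)

Section Rank.
Variable R : comNzRingType.
Implicit Types A B V : lmodType R.

(** A strictly increasing function from the submodules of [X] to the natural
    numbers bounds the length of the chains in [X]. Having such a function is
    thus equivalent to finite length, and it passes to submodules and extensions
    without any handling of chains. *)
Definition rank_fun A (l : submodClosed A -> nat) (X : submodClosed A) : Prop :=
  forall Y Z : submodClosed A, {subset Y <= Z} -> {subset Z <= X} ->
    (l Y <= l Z)%N /\ ((l Z <= l Y)%N -> {subset Z <= Y}).

Definition ranked A (X : submodClosed A) : Prop := exists l, rank_fun l X.

Lemma rankedS A (X Y : submodClosed A) :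
  {subset X <= Y} -> ranked Y -> ranked X.
Proof.
move=> XY [l lY]; exists l => Z T ZT TX; apply: lY => // x xT.
exact/XY/TX.
Qed.

Lemma ranked0 A (X : submodClosed A) : (forall x, x \in X -> x = 0) -> ranked X.
Proof.
move=> X0; exists (fun=> 0%N) => Y Z YZ ZX; split=> // _ x /ZX/X0->.
exact: rpred0.
Qed.

Lemma cap_closed A (U W : submodClosed A) :
  submod_prop (fun x => x \in U /\ x \in W).
Proof.
by split=> [|a x y [xU xW] [yU yW]]; rewrite ?rpred0 ?rpredD ?rpredZ.
Qed.
Definition capmod A (U W : submodClosed A) : submodClosed A :=
  submod_of (cap_closed U W).

Lemma in_capmod A (U W : submodClosed A) x :
  (x \in capmod U W) <-> (x \in U /\ x \in W).
Proof. exact: in_submod_of. Qed.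

(** The rank of [Z] is the sum of the rank of its intersection with the kernel
    and of the rank of its image. *)
Lemma ranked_extension A B (f : {linear A -> B})
    (X : submodClosed A) (Y : submodClosed B) :
  (forall x, x \in X -> f x \in Y) -> ranked Y ->
  ranked (capmod X (kermod f)) -> ranked X.
Proof.
move=> fXY [lY lYP] [lK lKP].
exists (fun Z => lK (capmod Z (kermod f)) + lY (submod_img f Z))%N => S T ST TX.
have [||capL capS] := lKP (capmod S (kermod f)) (capmod T (kermod f)).
- by move=> x /in_capmod[xS xK]; apply/in_capmod; split; first exact: ST.
- by move=> x /in_capmod[xT xK]; apply/in_capmod; split; first exact: TX.
have [||imgL imgS] := lYP (submod_img f S) (submod_img f T).
- move=> _ /in_submod_img[x xS ->]; apply/in_submod_img.
  by exists x => //; exact: ST.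
- by move=> _ /in_submod_img[x xT ->]; exact/fXY/TX.
split=> [|le_TS x xT]; first exact: leq_add.
have /imgS img_sub : (lY (submod_img f T) <= lY (submod_img f S))%N.
  rewrite -(leq_add2l (lK (capmod S (kermod f)))).
  by rewrite (leq_trans _ le_TS) ?leq_add2r.
have /capS cap_sub : (lK (capmod T (kermod f)) <= lK (capmod S (kermod f)))%N.
  by rewrite -(leq_add2r (lY (submod_img f S))) (leq_trans _ le_TS) ?leq_add2l.
have /img_sub/in_submod_img[s sS fxs] : f x \in submod_img f T.
  by apply/in_submod_img; exists x.
have /cap_sub/in_capmod[xsS _] : x - s \in capmod T (kermod f).
  apply/in_capmod; split; first by rewrite -scaleN1r rpredD ?rpredZ ?(ST _ sS).
  by apply/in_kermod; rewrite linearB /= fxs subrr.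
by rewrite -(subrK s x) rpredD.
Qed.

(** Filtering [X] by the successive kernels of the [f t] amounts to embedding
    the quotient of [X] by their common kernel in a power of [Y]. *)
Lemma ranked_family A B p (f : 'I_p -> {linear A -> B})
    (X K : submodClosed A) (Y : submodClosed B) :
  (forall t x, x \in X -> f t x \in Y) -> ranked Y ->
  (forall x, x \in X -> (forall t, f t x = 0) -> x \in K) -> ranked K ->
  ranked X.
Proof.
move=> fXY Yrk XK Krk.
have Kn_closed n : submod_prop
    (fun x => x \in X /\ forall t : 'I_p, (t < n)%N -> f t x = 0).
  split=> [|a x y [xX x0] [yX y0]].
    by rewrite rpred0; split=> // t _; exact: linear0.
  split=> [|t tn]; rewrite ?rpredD ?rpredZ //.
  by rewrite linearP x0 // y0 // scaler0 addr0.
pose Kn n : submodClosed A := submod_of (Kn_closed n).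
suff Kn_rk d n : (n + d)%N = p -> ranked (Kn n).
  apply: rankedS (Kn_rk p 0%N (add0n p)) => x xX.
  by apply/in_submod_of; split.
elim: d n => [|d IHd] n nE.
  apply: rankedS Krk => x /in_submod_of[xX x0]; apply: XK => // t.
  by apply: x0; rewrite -(addn0 n) nE.
have np : (n < p)%N by rewrite -nE addnS ltnS leq_addr.
apply: (ranked_extension (f := f (Ordinal np)) _ Yrk).
  by move=> x /in_submod_of[xX _]; exact: fXY.
apply: rankedS (IHd n.+1 _); last by rewrite addSnnS.
move=> x /in_capmod[/in_submod_of[xX xn] /in_kermod fx].
apply/in_submod_of; split=> // t; rewrite ltnS leq_eqVlt.
case/orP=> [/eqP tn|]; last exact: xn.
by rewrite -fx; congr (f _ x); exact: val_inj.
Qed.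

(** A proper submodule of [X] of largest rank is maximal, and induction applies
    to it. *)
Lemma ranked_finite_length A : ranked (fullmod A) -> finite_length A.
Proof.
move=> [l lP].
have {}lP (Y Z : submodClosed A) : {subset Y <= Z} ->
    (l Y <= l Z)%N /\ ((l Z <= l Y)%N -> {subset Z <= Y}).
  by move=> YZ; exact: lP.
suff series b : forall X : submodClosed A, (l X < b)%N ->
    exists n (U : nat -> submodClosed A),
    [/\ forall x, x \in U 0%N <-> x = 0, U n = X
      & forall i, (i < n)%N ->
        [/\ {subset U i <= U i.+1}, ~ {subset U i.+1 <= U i}
          & forall W : submodClosed A, {subset U i <= W} ->
              {subset W <= U i.+1} -> W =i U i \/ W =i U i.+1]].
  pose X : submodClosed A := fullmod A.
  have [n [U [U0 Un Us]]] := series (l X).+1 X (leqnn _).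
  by exists n, U; split=> // x; rewrite Un.
elim: b => [//|b IHb] X lX.
have [X0|] := pselect (forall x, x \in X -> x = 0).
  exists 0%N, (fun=> X); split=> // x.
  by split=> [/X0//|->]; exact: rpred0.
move=> /existsNP[x0 /not_implyP[x0X x0N0]].
pose P n := `[< exists Y : submodClosed A,
  [/\ {subset Y <= X}, ~ {subset X <= Y} & l Y = n] >].
have exP : exists n, P n.
  exists (l (kermod (idfun : {linear A -> A}))); apply/asboolP.
  exists (kermod (idfun : {linear A -> A})); split=> //.
    by move=> x /in_kermod/= ->; exact: rpred0.
  by move=> /(_ _ x0X)/in_kermod.
have leP n : P n -> (n <= l X)%N.
  by move=> /asboolP[Y [YX _ <-]]; exact: (lP _ _ YX).1.
case: (ex_maxnP exP leP) => _ /asboolP[Y [YX XY <-]] Ymax.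
have lYX : (l Y < l X)%N.
  by rewrite ltnNge; apply/negP => /(lP _ _ YX).2.
have [n [U [U0 Un Us]]] := IHb Y (leq_trans lYX lX).
exists n.+1, (fun i => if (i <= n)%N then U i else X).
split=> //; first by rewrite ltnn.
move=> i; rewrite ltnS => lein; rewrite lein.
have [ltin|lein'] := ltnP i n; first exact: Us.
have {lein lein'}-> : i = n by apply/eqP; rewrite eqn_leq lein.
rewrite Un; split=> // W YW WX.
have [XW|XW] := pselect {subset X <= W}.
  by right=> x; apply/idP/idP; [exact: WX | exact: XW].
left=> x; apply/idP/idP; last exact: YW.
apply: (lP _ _ YW).2; apply: Ymax; apply/asboolP.
by exists W.
Qed.

Section Maximal.
Variables (m : idealr R) (m_max : maximal_ideal m).

Lemma maximal_ideal_inv (a : R) : a \notin m ->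
  exists e r, e \in m /\ 1 = e + r * a.
Proof.
move=> am; apply: contrapT => ne.
pose J : {pred R} := fun x => `[< exists e r, e \in m /\ x = e + r * a >].
have J_closed : idealr_closed J.
  split; first by apply/asboolP; exists 0, 0; rewrite mul0r addr0 rpred0.
    by apply/negP => /asboolP.
  move=> b _ _ /asboolP[e [r [em ->]]] /asboolP[e' [r' [e'm ->]]].
  apply/asboolP; exists (b * e + e'), (b * r + r').
  by rewrite rpredD ?idealMr // mulrDr mulrDl mulrA addrACA.
pose J' : idealr R := HB.pack J (isIdealr.Build R J J_closed).
have mJ : {subset m <= J'}.
  by move=> e em; apply/asboolP; exists e, 0; rewrite mul0r addr0.
case/negP: am; rewrite -(m_max mJ); apply/asboolP.
by exists 0, 1; rewrite mul1r add0r rpred0.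
Qed.

(** As [c] belongs to all nonzero submodules and [m] is maximal, the submodule
    [A[m]] has no submodules but zero and itself, told apart by the presence of
    [c]. *)
Lemma ranked_monolith A (c : A) : c != 0 ->
  (forall x, x != 0 -> exists a : R, c = a *: x) -> ranked (annmod A m).
Proof.
move=> c0 cP; exists (fun Z : submodClosed A => (c \in Z) : nat) => Y Z YZ ZA.
split.
  by case cY: (c \in Y); rewrite // YZ.
move=> cZY z zZ; have [->|z0] := eqVneq z 0; first exact: rpred0.
have [a cE] := cP z z0.
have az x : x \in m -> x *: z = 0 by move: x; apply/in_annmod/ZA.
have [am|am] := boolP (a \in m); first by rewrite cE az ?eqxx in c0.
have [e [r [em oneE]]] := maximal_ideal_inv am.
rewrite -[z]scale1r oneE scalerDl az // add0r -scalerA -cE rpredZ //.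
by move: cZY; rewrite {1}cE rpredZ //; case: (c \in Y).
Qed.

(** Multiplication by generators of [m] embeds [A[m^(n+1)]/A[m]] in a power of
    [A[m^n]], and [A[m]] is covered by [ranked_monolith]. *)
Lemma ranked_torsion A (c : A) n : noetherian_ring R -> c != 0 ->
  (forall x, x != 0 -> exists a : R, c = a *: x) ->
  ranked (annmod A (idealX m n)).
Proof.
move=> R_noeth c0 cP; have [p [g gE]] := noetherian_ideal_gen m R_noeth.
elim: n => [|n IHn].
  by apply: ranked0 => x /in_annmod/(_ 1 isT); rewrite scale1r.
have gm t := generates_mem t gE.
apply: (ranked_family (f := fun t => *:%R (g t) : {linear A -> A})
  _ IHn _ (ranked_monolith c0 cP)).
  move=> t x /in_annmod xn; apply/in_annmod => b bn.
  by rewrite /= scalerA mulrC xn // (@mem_smulmod R R^o).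
move=> x _ gx; apply/in_annmod => a /gE[d ->].
by rewrite scaler_suml big1 // => t _; rewrite -scalerA gx scaler0.
Qed.

Lemma maximal_avoiding A (D : submodClosed A) c : c \notin D ->
  exists D' : submodClosed A, [/\ {subset D <= D'}, c \notin D'
    & forall X : submodClosed A, {subset D' <= X} -> c \notin X ->
        {subset X <= D'}].
Proof.
move=> cD; pose T := {X : submodClosed A | {subset D <= X} /\ c \notin X}.
pose sub (X Y : T) := `[< {subset sval X <= sval Y} >].
pose D0 : T := exist _ D (conj (fun _ => id) cD).
have [|||[D' [DD' cD']] D'max] := @ZL_preorder T D0 sub.
- by move=> X; exact/asboolP.
- by move=> Y X Z /asboolP XY /asboolP YZ; apply/asboolP => x /XY/YZ.
- move=> C Ctot; have [[X0 CX0]|C0] := pselect (exists X, C X); last first.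
    by exists D0 => X CX; case: C0; exists X.
  have U_closed : submod_prop (fun x => exists2 X, C X & x \in sval X).
    split=> [|a x y [X CX xX] [Y CY yY]]; first by exists X0; rewrite ?rpred0.
    have [/asboolP XY|/asboolP YX] := Ctot X Y CX CY.
      by exists Y => //; rewrite rpredD ?rpredZ // XY.
    by exists X => //; rewrite rpredD ?rpredZ // YX.
  pose U : submodClosed A := submod_of U_closed.
  have UT : {subset D <= U} /\ c \notin U.
    split=> [x xD|].
      by apply/in_submod_of; exists X0 => //; exact: (svalP X0).1.
    by apply/negP => /in_submod_of[X _ cX]; case/negP: (svalP X).2.
  exists (exist _ U UT) => X CX; apply/asboolP => x xX /=.
  by apply/in_submod_of; exists X.
exists D'; split=> // X D'X cX.
have XT : {subset D <= X} /\ c \notin X by split=> // x /DD'/D'X.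
by have /asboolP := D'max (exist _ X XT) (asboolT D'X).
Qed.

(** Enlarge [D] to [D'] maximal among the submodules avoiding [c]. Then the
    class of [c] lies in every nonzero submodule of [A/D'], and [m^n] kills
    [A/D']. *)
Lemma ranked_avoiding A (D : submodClosed A) c n : noetherian_ring R ->
  c \notin D -> {subset adic m n A <= D} ->
  exists D' : submodClosed A,
    [/\ {subset D <= D'}, c \notin D' & ranked (fullmod (quot_mod D'))].
Proof.
move=> R_noeth cD nD; have [D' [DD' cD' D'max]] := maximal_avoiding cD.
exists D'; split=> //.
have c0 : quot_pi D' c != 0 by apply/eqP => /quot_pi_eq0; exact/negP.
apply: rankedS (ranked_torsion n R_noeth c0 _) => [x _|y].
  have [u ->] := quot_pi_surj x; apply/in_annmod => a an.
  by rewrite -linearZ; apply/quot_pi_eq0/DD'/nD/mem_smulmod.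
have [x ->] := quot_pi_surj y => x0.
have [|cX] := boolP (c \in submodD D' (line x)).
  move=> /in_submodD[d [_ [dD' /in_line[a ->] ->]]].
  by exists a; rewrite linearD linearZ /= (quot_pi_eq0 _ _).2 // add0r.
case/eqP: x0; apply/quot_pi_eq0; apply: (D'max (submodD D' (line x))) => //.
  by move=> d dD'; apply/in_submodD; exists d, 0; rewrite addr0 rpred0.
apply/in_submodD; exists 0, x; rewrite add0r rpred0; split=> //.
by apply/in_line; exists 1; rewrite scale1r.
Qed.

End Maximal.
End Rank.

(** * The quotient by H *)

Section Hausdorff.
Variables (R : comNzRingType) (m : idealr R).
Hypotheses (R_noeth : noetherian_ring R) (m_max : maximal_ideal m).
Implicit Types A B V : lmodType R.

Definition solvable_mod V (U : submodClosed V) k l (r : 'M[R]_(k, l))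
    (c : 'I_k -> V) : Prop :=
  exists y : 'I_l -> V, forall i, c i - \sum_(j < l) r i j *: y j \in U.

(** The right-hand sides solvable modulo [m^n V] form a submodule [D] of [V^k]
    avoiding [c]; let [D'] be as in [ranked_avoiding]. The submodule [W] is the
    largest one with [W^k] contained in [D'], so that [V/W] embeds in a power of
    [V^k/D'], while a solution modulo [W] would put [c] in [D']. *)
Lemma unsolvable_finite_length V n k l (r : 'M[R]_(k, l)) (c : 'I_k -> V) :
  ~ solvable_mod (adic m n V) r c ->
  exists W : submodClosed V, [/\ finite_length (quot_mod W),
    {subset adic m n V <= W} & ~ solvable_mod W r c].
Proof.
move=> nsol.
have D_closed : submod_prop (fun v : power 'I_k V =>
    solvable_mod (adic m n V) r v).
  split=> [|a v w [y yE] [z zE]].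
    exists (fun=> 0) => i; rewrite big1 => [|j _]; last exact: scaler0.
    by rewrite subr0 rpred0.
  exists (fun j => a *: y j + z j) => i.
  under eq_bigr do rewrite scalerDr scalerA mulrC -scalerA.
  rewrite big_split -scaler_sumr /= opprD addrACA -scalerBr.
  by rewrite rpredD ?rpredZ.
pose D : submodClosed (power 'I_k V) := submod_of D_closed.
have cD : (c : power 'I_k V) \notin D by apply/negP => /in_submod_of.
have nD : {subset adic m n (power 'I_k V) <= D}.
  apply: smulmod_sub => a v am _; apply/in_submod_of; exists (fun=> 0) => i.
  rewrite big1 => [|j _]; last exact: scaler0.
  by rewrite subr0; exact: (@mem_smulmod R V).
have [D' [DD' cD' D'rk]] := ranked_avoiding m_max R_noeth cD nD.
(* io i maps x to the class of the vector with x at place i. *)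
have io_lin i : linear (fun x : V => quot_pi D'
    ((fun j => if j == i then x else 0) : power 'I_k V)).
  move=> a x y; rewrite -linearP; congr (quot_pi _ _).
  apply: functional_extensionality_dep => j.
  rewrite -[RHS]/(a *: (if j == i then x else 0) + (if j == i then y else 0)).
  by case: eqP => // _; rewrite scaler0 addr0.
pose io i : {linear V -> quot_mod D'} :=
  HB.pack (fun x : V => quot_pi D'
    ((fun j => if j == i then x else 0) : power 'I_k V))
    (GRing.isLinear.Build _ _ _ _ _ (io_lin i)).
have W_closed : submod_prop (fun x : V => forall i, io i x = 0).
  split=> [i|a x y x0 y0 i]; first exact: linear0.
  by rewrite linearP x0 y0 scaler0 addr0.
pose W : submodClosed V := submod_of W_closed.
exists W; split.
- apply: ranked_finite_length.
  have /choice[ps psE] : forall i, exists g :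
      {linear quot_mod W -> quot_mod D'}, forall x, g (quot_pi W x) = io i x.
    by move=> i; apply: quot_lift_ex => x /in_submod_of.
  pose Z : submodClosed (quot_mod W) :=
    kermod (idfun : {linear quot_mod W -> quot_mod W}).
  apply: (ranked_family (f := ps) (K := Z) _ D'rk) => //.
    move=> x _ x0; apply/in_kermod => /=; have [u uE] := quot_pi_surj x.
    rewrite uE; apply/quot_pi_eq0/in_submod_of => i.
    by rewrite -psE -uE.
  by apply: ranked0 => x /in_kermod.
- move=> x xn; apply/in_submod_of => i; apply/quot_pi_eq0/DD'/in_submod_of.
  exists (fun=> 0) => j; rewrite big1 => [|t _]; last exact: scaler0.
  by rewrite subr0; case: eqP => // _; rewrite rpred0.
- move=> [y yE]; case/negP: cD'.
  pose ry : power 'I_k V := fun i => \sum_(j < l) r i j *: y j.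
  have ryD : ry \in D'.
    apply/DD'/in_submod_of; exists y => i; rewrite subrr; exact: rpred0.
  rewrite -(subrK ry (c : power 'I_k V)) rpredD //.
  have -> : (c : power 'I_k V) - ry = \sum_(i < k)
      ((fun j => if j == i then c i - ry i else 0) : power 'I_k V).
    apply: functional_extensionality_dep => j; rewrite sum_power.
    by rewrite -big_mkcond /= (big_pred1 j).
  apply: rpred_sum => i _; apply/quot_pi_eq0.
  by have /in_submod_of := yE i; exact.
Qed.

(** The limit over [n] of solutions modulo [m^n V] is a solution modulo each
    [m^n V]. *)
Lemma solvable_mod_Hmod V k l (r : 'M[R]_(k, l)) (c : 'I_k -> V) :
  has_limits V -> (forall n, solvable_mod (adic m n V) r c) ->
  solvable_mod (Hmod m V) r c.
Proof.
move=> VL sol; have /choice[y yE] : forall n, exists y : 'I_l -> V,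
    forall i, c i - \sum_(j < l) r i j *: y j \in adic m n V := sol.
have [L LF] := VL _ _ eventually_filter.
exists (fun j => L (fun n => y n j)) => i; apply/in_Hmod => n.
rewrite -(flimit_sum L (fun j => r i j) (fun j n => y n j)) -[c i]LF.1 -linearB.
apply: (noetherian_smulmod_closed R_noeth _ LF); exists n => // k' /= nk'.
exact: (adic_le nk' (yE k' i)).
Qed.

Lemma retract_direct_summand A B (f : {linear A -> B}) (h : {linear B -> A}) :
  h \o f =1 id -> direct_summand A B.
Proof.
move=> hf; pose C := submod_type (kermod h).
pose s (p : A * C) : B := f p.1 + val p.2.
have s_lin : linear s.
  by move=> a [x u] [y v]; rewrite /s /= linearP scalerDr addrACA.
pose s' : {linear (A * C)%type -> B} :=
  HB.pack s (GRing.isLinear.Build _ _ _ _ _ s_lin).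
exists C, s'.
have kerP b : b - f (h b) \in kermod h.
  by apply/in_kermod; rewrite linearB -[h (f _)]/((h \o f) _) hf subrr.
exists (fun b => (h b, exist (fun v => v \in kermod h) _ (kerP b))).
  move=> [a u].
  rewrite /= /s /=; have hu : h (val u) = 0 by apply/in_kermod/(valP u).
  have ha : h (f a + val u) = a.
    by rewrite linearD hu addr0 -[LHS]/((h \o f) a) hf.
  congr (_, _) => //; apply: val_inj => /=; rewrite ha.
  by rewrite addrC addKr.
by move=> b; rewrite /= /s /= addrC subrK.
Qed.

(** The canonical map [E] to the product of the quotients of finite length is
    pure, and [V/H(V)], being pure-injective, is a retract of it. *)
Lemma quot_Hmod_direct_summand V : has_limits V ->
  exists (I : Type) (F : I -> lmodType R),
    (forall i, finite_length (F i)) /\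
    direct_summand (quot_mod (Hmod m V)) (prod_mod F).
Proof.
move=> VL; pose H : submodClosed V := Hmod m V.
pose I := {W : submodClosed V | finite_length (quot_mod W) /\ {subset H <= W}}.
pose F (W : I) : lmodType R := quot_mod (sval W).
exists I, F; split=> [W|]; first exact: (svalP W).1.
have proj W : {g : {linear quot_mod H -> F W} |
    forall x, g (quot_pi H x) = quot_pi (sval W) x}.
  apply/cid/quot_lift_ex => x xH.
  by apply/quot_pi_eq0; exact: (svalP W).2.
pose e W := sval (proj W).
have eE W x : e W (quot_pi H x) = quot_pi (sval W) x := svalP (proj W) x.
have e_lin : linear (fun x => (fun W => e W x) : prod_mod F).
  move=> a x y; apply: functional_extensionality_dep => W.
  by rewrite linearP.
pose E : {linear quot_mod H -> prod_mod F} :=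
  HB.pack (fun x => (fun W => e W x) : prod_mod F)
    (GRing.isLinear.Build _ _ _ _ _ e_lin).
have sumE n (x : 'I_n -> prod_mod F) W : (\sum_j x j) W = \sum_j x j W.
  by elim/big_ind2: _ => // a b c d <- <-.
have E_pure : pure_map E.
  move=> k l r c [y yE].
  have /choice[v vE] : forall i, exists v, c i = quot_pi H v.
    by move=> i; exact: quot_pi_surj.
  suff [z zE] : solvable_mod H r v.
    exists (fun j => quot_pi H (z j)) => i; rewrite vE; symmetry.
    under eq_bigr do rewrite -linearZ.
    by rewrite -linear_sum; apply/quot_piE.
  apply: solvable_mod_Hmod => // n; apply: contrapT.
  move=> /unsolvable_finite_length[W [W_fin nW]]; apply.
  have HW : {subset H <= W} by move=> x /in_Hmod/(_ n)/nW.
  pose i0 : I := exist _ W (conj W_fin HW).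
  have /choice[z zE] : forall j, exists z, y j i0 = quot_pi W z.
    by move=> j; exact: quot_pi_surj.
  exists z => i; apply/quot_piE; transitivity (E (c i) i0).
    by rewrite vE /= eE.
  rewrite -(yE i) sumE linear_sum; apply: eq_bigr => j _.
  by rewrite linearZ; congr (_ *: _); exact: zE.
have [h hE] : exists h : {linear prod_mod F -> quot_mod H}, h \o E =1 idfun.
  have /pure_injectiveP : pure_injective (quot_mod H); last by apply.
  apply/has_limits_pure_injective/has_limits_quot => //.
  exact: Hmod_flimit_closed.
exact: retract_direct_summand hE.
Qed.
End Hausdorff.

Theorem lemma5 (R : comNzRingType) (m : idealr R)
    (R_noeth : noetherian_ring R) (R_local : local_ring m)
    (M N : lmodType R) (f : {linear M -> N})
    (f_hull : pure_injective_hull f) :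
  [/\ Koatt N = Koatt M,
      radical_full m (submod_type (Hmod m N)) /\
      pure_injective (submod_type (Hmod m N))
    & exists (I : Type) (F : I -> lmodType R),
        (forall i, finite_length (F i)) /\
        direct_summand (quot_mod (Hmod m N)) (prod_mod F)].
Proof.
have [f_inj f_ess /pure_injective_limits N_lim] := f_hull.
have [m_max _] := R_local.
split.
- exact: Koatt_pure_essential f_inj f_ess.
- split; first exact: Hmod_radical_full.
  apply/has_limits_pure_injective/has_limits_submod => //.
  exact: Hmod_flimit_closed.
- exact: quot_Hmod_direct_summand.
Qed.
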